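(* Let $A$ be a non-commutative local ring such that $A/\operatorname{Rad}(A)\neq \mathbb{F}_2$, where $\mathbb{F}_2$ is the field with two elements. Put $\Gamma=A^{*}$, the group of units of $A$, acting on $A$ by conjugation. Let $\tau:U(A)\to[A^{*},A^{*}]$ be the canonical surjective $A^*$-homomorphism with kernel $K_2(A)$, and let $\Gamma(\tau):\Gamma U(A)\to\Gamma[A^*,A^*]$ be its restriction. Then there is an exact sequence $$0\to \operatorname{Ker}\Gamma(\tau)/\Gamma(K_2(A))\to (K_2(A))_{A^{*}}\to Sym^{A^{*}}(A)\to [A^{*},A^{*}]/\Gamma([A^{*},A^{*}])\to 0 .$$
   Context: For a group $\Gamma$ acting on a group $G$ by automorphisms, $\Gamma G$ (also written $\Gamma(G)$) denotes the normal subgroup of $G$ generated by all ${}^{\gamma}g\,g^{-1}$ ($g\in G$, $\gamma\in\Gamma$), and $G_\Gamma=G/\Gamma G$. The symbol group $Sym(A)$ is the group generated by elements $\langle u,v\rangle$, $u,v\in A^{*}$, with relations: $\langle u,1-u\rangle=1$ for $u\neq1$, $1-u\in A^{*}$; $\langle uu',v\rangle=\langle u,v\rangle\langle u',v\rangle$; $\langle u,vv'\rangle=\langle u,v\rangle\langle u,v'\rangle$. The group $A^{*}$ acts on it by ${}^{\gamma}\langle u,v\rangle=\langle\gamma u\gamma^{-1},\gamma v\gamma^{-1}\rangle$, and $Sym^{A^{*}}(A)=(Sym(A))_{A^{*}}$. The group $U(A)$ is generated by elements $\langle u,v\rangle$, $u,v\in A^{*}$, with relations: $\langle u,1-u\rangle=1$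 for $u\neq 1$, $1-u\in A^{*}$; $\langle uv,w\rangle={}^{u}\langle v,w\rangle\,\langle u,w\rangle$; $\langle u,vw\rangle\langle v,wu\rangle\langle w,uv\rangle=1$; here ${}^{u}\langle v,w\rangle=\langle uvu^{-1},uwu^{-1}\rangle$. The group $A^{*}$ acts on $U(A)$ by ${}^{\gamma}\langle v,w\rangle=\langle\gamma v\gamma^{-1},\gamma w\gamma^{-1}\rangle$, and on the commutator subgroup $[A^{*},A^{*}]$ by conjugation. The map $\tau$ is $\langle u,v\rangle\mapsto uvu^{-1}v^{-1}$. For such $A$ there is a known exact sequence (Guin) $0\to K_2(A)\to U(A)\xrightarrow{\tau}[A^{*},A^{*}]\to e$, through which $K_2(A)$ is regarded as an $A^{*}$-subgroup of $U(A)$. *)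

(* Defs.v *)
From HB Require Import structures.
From mathcomp Require Import all_boot all_order all_algebra.
From mathcomp Require Import boolp.

Set Implicit Arguments.
Unset Strict Implicit.
Unset Printing Implicit Defensive.

Import GRing.Theory.

Local Open Scope quotient_scope.
Local Open Scope group_scope.

Definition subg (G : groupType) (H : groupClosed G) := {x : G | x \in H}.

Section Subg.
Variables (G : groupType) (H : groupClosed G).

HB.instance Definition _ := SubChoice.on (subg H).

Lemma subg_closed : group_closed H.
Proof. by split; [exact: gpred1 | exact: gpredF]. Qed.

HB.instance Definition _ :=
  SubChoice_isSubGroup.Build G (fun x => x \in H) (subg H) subg_closed.
End Subg.

Record normalSubgroup (G : groupType) (H : groupClosed G) := NormalSubgroup {
  nsub :> groupClosed G;
  nsub_sub : {subset nsub <= H};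
  nsub_norm : forall h x, h \in H -> x \in nsub -> h * x * h^-1 \in nsub
}.

Section Quotient.
Variables (G : groupType) (H : groupClosed G) (N : normalSubgroup H).

Definition quo_rel (x y : subg H) : bool := val x / val y \in N.

Lemma quo_rel_refl : reflexive quo_rel.
Proof. by move=> x; rewrite /quo_rel mulgV gpred1. Qed.

Lemma quo_rel_sym : symmetric quo_rel.
Proof. by move=> x y; rewrite /quo_rel gpredFC. Qed.

Lemma quo_rel_trans : transitive quo_rel.
Proof.
by move=> y x z xy yz; rewrite /quo_rel -(divgKA (val y)) gpredM.
Qed.

Canonical quo_equiv := EquivRel quo_rel quo_rel_refl quo_rel_sym quo_rel_trans.

Definition quo := {eq_quot quo_equiv}.

HB.instance Definition _ : EqQuotient _ quo_equiv quo := EqQuotient.on quo.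
HB.instance Definition _ := Choice.on quo.

Lemma quoP (x y : subg H) :
  reflect (\pi_quo x = \pi_quo y) (val x / val y \in N).
Proof. by apply: (iffP idP) => [xy|/eqmodP//]; apply/eqmodP. Qed.

Definition quo_one : quo := \pi_quo (1 : subg H).
Definition quo_mul (x y : quo) : quo := \pi_quo ((repr x : subg H) * (repr y : subg H)).

Definition quo_inv (x : quo) : quo := \pi_quo (repr x : subg H)^-1.

Lemma pi_quo_mul (x y : subg H) : \pi_quo (x * y) = quo_mul (\pi_quo x) (\pi_quo y).
Proof.
apply/quoP; rewrite !valM.
have /quoP ax : \pi_quo x = \pi_quo (repr (\pi_quo x)) by rewrite reprK.
have /quoP ay : \pi_quo y = \pi_quo (repr (\pi_quo y)) by rewrite reprK.
rewrite invgM mulgA -(mulgA (val x)).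
set a := val (repr (\pi_quo x)) in ax *; set b := _ / _ in ay *.
have -> : val x * b / a = val x * b * (val x)^-1 * (val x / a).
  by rewrite !mulgA mulgVK.
by rewrite gpredM // nsub_norm // (valP x).
Qed.

Lemma pi_quo_inv (x : subg H) : \pi_quo x^-1 = quo_inv (\pi_quo x).
Proof.
apply/quoP; rewrite gmulfV invgK.
have /quoP ax : \pi_quo x = \pi_quo (repr (\pi_quo x)) by rewrite reprK.
set a := val (repr (\pi_quo x)) in ax *.
have -> : (val x)^-1 * a = (val x)^-1 * (val x / a)^-1 * (val x)^-1^-1.
  by rewrite invgF invgK -mulgA mulgVK.
by rewrite nsub_norm ?gpredV // (valP x).
Qed.

Lemma quo_ind (P : quo -> Prop) : (forall x : subg H, P (\pi_quo x)) -> forall x, P x.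
Proof. by move=> h x; rewrite -[x]reprK; exact: h. Qed.

Lemma quo_mulA : associative quo_mul.
Proof.
move=> x y z; elim/quo_ind: x => x; elim/quo_ind: y => y; elim/quo_ind: z => z.
by rewrite -!pi_quo_mul mulgA.
Qed.

Lemma quo_mul1 : left_id quo_one quo_mul.
Proof. by move=> x; elim/quo_ind: x => x; rewrite -pi_quo_mul mul1g. Qed.

Lemma quo_1mul : right_id quo_one quo_mul.
Proof. by move=> x; elim/quo_ind: x => x; rewrite -pi_quo_mul mulg1. Qed.

Lemma quo_mulV : left_inverse quo_one quo_inv quo_mul.
Proof.
by move=> x; elim/quo_ind: x => x; rewrite -pi_quo_inv -pi_quo_mul mulVg.
Qed.

Lemma quo_Vmul : right_inverse quo_one quo_inv quo_mul.
Proof.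
by move=> x; elim/quo_ind: x => x; rewrite -pi_quo_inv -pi_quo_mul mulgV.
Qed.

HB.instance Definition _ :=
  isGroup.Build quo quo_mulA quo_mul1 quo_1mul quo_mulV quo_Vmul.

(* As for coset in finite group theory, coset x is only meaningful for x in H;
   it is 1 when x is not in H. *)
Definition coset (x : G) : quo := \pi_quo (insubd (1 : subg H) x).

End Quotient.

Record autAction (Gam G : groupType) := AutAction {
  act :> Gam -> G -> G;
  act1 : forall x, act 1 x = x;
  actM : forall a b x, act (a * b) x = act a (act b x);
  act_morph : forall a, {morph act a : x y / x * y}
}.

Record stableSubgroup (Gam G : groupType) (to : autAction Gam G) :=
  StableSubgroup {
    ssub :> groupClosed G;
    ssub_stable : forall a x, x \in ssub -> to a x \in ssub
  }.

Section Coinvariants.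
Variables (Gam G : groupType) (to : autAction Gam G).

Section GammaSub.
Variable H : stableSubgroup to.

(* The smallest subgroup of G that is normalised by H and contains all the
   elements to a x * x^-1 with x in H; it lies in H because H is stable. *)
Definition gammaSub : {pred G} := fun g => `[< forall N : groupClosed G,
  (forall a x, x \in H -> to a x * x^-1 \in N) ->
  (forall h x, h \in H -> x \in N -> h * x * h^-1 \in N) -> g \in N >].

Lemma gammaSubM : mulg_closed gammaSub.
Proof.
move=> x y /asboolP xP /asboolP yP; apply/asboolP => N N1 N2.
by rewrite gpredM ?xP ?yP.
Qed.

Lemma gammaSub1 : 1 \in gammaSub.
Proof. by apply/asboolP => N _ _; exact: gpred1. Qed.

Lemma gammaSubV : invg_closed gammaSub.
Proof.
by move=> x /asboolP xP; apply/asboolP => N N1 N2; rewrite gpredV xP.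
Qed.

HB.instance Definition _ := isMulClosed.Build G gammaSub gammaSubM.
HB.instance Definition _ := isMul1Closed.Build G gammaSub gammaSub1.
HB.instance Definition _ := isInvClosed.Build G gammaSub gammaSubV.

Lemma gammaSub_sub : {subset gammaSub <= H}.
Proof.
move=> x /asboolP; apply=> [a y yH|h y hH yH].
  by rewrite gpredF // ssub_stable.
by rewrite gpredF // gpredM.
Qed.

Lemma gammaSub_norm h x : h \in H -> x \in gammaSub -> h * x * h^-1 \in gammaSub.
Proof.
move=> hH /asboolP xP; apply/asboolP => N N1 N2.
by apply: (N2) => //; exact: xP.
Qed.

Definition gammaNormal : normalSubgroup H :=
  NormalSubgroup (nsub := gammaSub) gammaSub_sub gammaSub_norm.

Definition coinv := quo gammaNormal.

Definition coinv_class (x : G) : coinv := coset gammaNormal x.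

End GammaSub.

Definition fullSub : {pred G} := predT.
Lemma fullSubM : mulg_closed fullSub. Proof. by move=> *; exact: isT. Qed.
Lemma fullSub1 : 1 \in fullSub. Proof. exact: isT. Qed.
Lemma fullSubV : invg_closed fullSub. Proof. by move=> *; exact: isT. Qed.
HB.instance Definition _ := isMulClosed.Build G fullSub fullSubM.
HB.instance Definition _ := isMul1Closed.Build G fullSub fullSub1.
HB.instance Definition _ := isInvClosed.Build G fullSub fullSubV.

Definition wholeGroup : stableSubgroup to :=
  StableSubgroup (to := to) (ssub := fullSub) (fun _ _ _ => isT).

End Coinvariants.

HB.instance Definition _ (Gam G : groupType) (to : autAction Gam G)
  (H : stableSubgroup to) := Group.on (coinv H).

Section Conjugation.
Variable G : groupType.

Definition conj_act (a x : G) : G := a * x * a^-1.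

Lemma conj_act1 x : conj_act 1 x = x.
Proof. by rewrite /conj_act mul1g divg1. Qed.

Lemma conj_actM a b x : conj_act (a * b) x = conj_act a (conj_act b x).
Proof. by rewrite /conj_act invgM !mulgA. Qed.

Lemma conj_act_morph a : {morph conj_act a : x y / x * y}.
Proof. by move=> x y; rewrite /conj_act !mulgA mulgVK. Qed.

Definition conjAction : autAction G G :=
  AutAction conj_act1 conj_actM conj_act_morph.

Definition commSub : {pred G} := fun g =>
  `[< forall N : groupClosed G, (forall u v, u * v * u^-1 * v^-1 \in N) -> g \in N >].

Lemma commSubM : mulg_closed commSub.
Proof.
by move=> x y /asboolP xP /asboolP yP; apply/asboolP => N NP; rewrite gpredM ?xP ?yP.
Qed.

Lemma commSub1 : 1 \in commSub.
Proof. by apply/asboolP => N _; exact: gpred1. Qed.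

Lemma commSubV : invg_closed commSub.
Proof. by move=> x /asboolP xP; apply/asboolP => N NP; rewrite gpredV xP. Qed.

HB.instance Definition _ := isMulClosed.Build G commSub commSubM.
HB.instance Definition _ := isMul1Closed.Build G commSub commSub1.
HB.instance Definition _ := isInvClosed.Build G commSub commSubV.

Lemma mem_commSub u v : u * v * u^-1 * v^-1 \in commSub.
Proof. by apply/asboolP => N; apply. Qed.

Lemma commSub_stable a x : x \in commSub -> conj_act a x \in commSub.
Proof.
move=> xC; have -> : conj_act a x = a * x * a^-1 * x^-1 * x by rewrite mulgVK.
by rewrite gpredM // mem_commSub.
Qed.

Definition commStable : stableSubgroup conjAction :=
  StableSubgroup (to := conjAction) (ssub := commSub) commSub_stable.

End Conjugation.

(* (x, true) stands for the generator x and (x, false) for its inverse. *)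
Definition word (X : choiceType) := seq (X * bool).

Inductive presEq (X : choiceType) (R : word X -> word X -> Prop) :
    word X -> word X -> Prop :=
| PresRel w w' of R w w' : presEq R w w'
| PresCancel x b : presEq R [:: (x, b); (x, ~~ b)] [::]
| PresCat w1 w1' w2 w2' of presEq R w1 w1' & presEq R w2 w2' :
    presEq R (w1 ++ w2) (w1' ++ w2')
| PresRefl w : presEq R w w
| PresSym w w' of presEq R w w' : presEq R w' w
| PresTrans w w' w'' of presEq R w w' & presEq R w' w'' : presEq R w w''.

Section Presented.
Variables (X : choiceType) (R : word X -> word X -> Prop).

Definition pres_rel (w w' : word X) : bool := `[< presEq R w w' >].

Lemma pres_rel_refl : reflexive pres_rel.
Proof. by move=> w; apply/asboolP; exact: PresRefl. Qed.

Lemma pres_rel_sym : symmetric pres_rel.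
Proof.
by move=> w w'; apply/idP/idP => /asboolP h; apply/asboolP; exact: PresSym.
Qed.

Lemma pres_rel_trans : transitive pres_rel.
Proof.
by move=> w2 w1 w3 /asboolP h1 /asboolP h2; apply/asboolP; exact: PresTrans h2.
Qed.

Canonical pres_equiv := EquivRel pres_rel pres_rel_refl pres_rel_sym pres_rel_trans.

Definition presented := {eq_quot pres_equiv}.

HB.instance Definition _ : EqQuotient _ pres_equiv presented :=
  EqQuotient.on presented.
HB.instance Definition _ := Choice.on presented.

Lemma presP (w w' : word X) :
  \pi_presented w = \pi_presented w' <-> presEq R w w'.
Proof. by split => [/eqmodP/asboolP|h]//; apply/eqmodP/asboolP. Qed.

Definition inv_word (w : word X) : word X := rev [seq (a.1, ~~ a.2) | a <- w].

Lemma inv_wordK : involutive inv_word.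
Proof.
move=> w; rewrite /inv_word map_rev revK -map_comp -[RHS]map_id.
by apply: eq_map => -[x b] /=; rewrite negbK.
Qed.

Lemma inv_wordV w : presEq R (w ++ inv_word w) [::].
Proof.
elim: w => [|[x b] w IHw]; first exact: PresRefl.
have -> : ((x, b) :: w) ++ inv_word ((x, b) :: w) =
    [:: (x, b)] ++ ((w ++ inv_word w) ++ [:: (x, ~~ b)]).
  by rewrite /inv_word /= rev_cons -cats1 catA.
apply: PresTrans (PresCancel R x b).
apply: (PresCat (w1' := [:: (x, b)]) (w2' := [::] ++ [:: (x, ~~ b)])).
  exact: PresRefl.
by apply: PresCat => //; exact: PresRefl.
Qed.

Lemma inv_wordP w w' : presEq R w w' -> presEq R (inv_word w) (inv_word w').
Proof.
move=> h.
have h1 : presEq R (inv_word w) (inv_word w ++ (w' ++ inv_word w')).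
  rewrite -[X in presEq R X _]cats0; apply: PresCat; first exact: PresRefl.
  exact/PresSym/inv_wordV.
apply: PresTrans h1 _; rewrite catA -[X in presEq R _ X]cat0s.
apply: PresCat; last exact: PresRefl.
apply: (@PresTrans _ _ _ (inv_word w ++ w)).
  by apply: PresCat; [exact: PresRefl | exact: PresSym].
by rewrite -{2}[w]inv_wordK; exact: inv_wordV.
Qed.

Definition pres_one : presented := \pi_presented [::].
Definition pres_mul (x y : presented) : presented := \pi_presented (repr x ++ repr y).
Definition pres_inv (x : presented) : presented := \pi_presented (inv_word (repr x)).

Lemma repr_pres w : presEq R w (repr (\pi_presented w)).
Proof. by apply/presP; rewrite reprK. Qed.

Lemma pi_pres_mul w w' : \pi_presented (w ++ w') = pres_mul (\pi_presented w) (\pi_presented w').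
Proof. by apply/presP; apply: PresCat; exact: repr_pres. Qed.

Lemma pi_pres_inv w : \pi_presented (inv_word w) = pres_inv (\pi_presented w).
Proof. by apply/presP/inv_wordP/repr_pres. Qed.

Lemma presented_ind (P : presented -> Prop) :
  (forall w, P (\pi_presented w)) -> forall x, P x.
Proof. by move=> h x; rewrite -[x]reprK; exact: h. Qed.

Lemma pres_mulA : associative pres_mul.
Proof.
move=> x y z; elim/presented_ind: x => x; elim/presented_ind: y => y.
by elim/presented_ind: z => z; rewrite -!pi_pres_mul catA.
Qed.

Lemma pres_mul1 : left_id pres_one pres_mul.
Proof. by move=> x; elim/presented_ind: x => x; rewrite -pi_pres_mul. Qed.

Lemma pres_1mul : right_id pres_one pres_mul.
Proof. by move=> x; elim/presented_ind: x => x; rewrite -pi_pres_mul cats0. Qed.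

Lemma pres_mulV : left_inverse pres_one pres_inv pres_mul.
Proof.
move=> x; elim/presented_ind: x => x; rewrite -pi_pres_inv -pi_pres_mul.
by apply/presP; rewrite -{2}[x]inv_wordK; exact: inv_wordV.
Qed.

Lemma pres_Vmul : right_inverse pres_one pres_inv pres_mul.
Proof.
move=> x; elim/presented_ind: x => x; rewrite -pi_pres_inv -pi_pres_mul.
exact/presP/inv_wordV.
Qed.

HB.instance Definition _ :=
  isGroup.Build presented pres_mulA pres_mul1 pres_1mul pres_mulV pres_Vmul.

Definition pgen (x : X) : presented := \pi_presented [:: (x, true)].

Lemma pi_pres_rcat w w' :
  \pi_presented (w ++ w') = \pi_presented w * \pi_presented w'.
Proof. exact: pi_pres_mul. Qed.

Section Lift.
Variables (G : groupType) (f : X -> G).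

Definition eval_word (w : word X) : G :=
  \prod_(a <- w) (if a.2 then f a.1 else (f a.1)^-1).

Lemma eval_cat w w' : eval_word (w ++ w') = eval_word w * eval_word w'.
Proof. exact: big_cat. Qed.

Hypothesis fR : forall w w', R w w' -> eval_word w = eval_word w'.

Lemma eval_presEq w w' : presEq R w w' -> eval_word w = eval_word w'.
Proof.
elim=> {w w'} [w w' /fR//|x b|w1 w1' w2 w2' _ IH1 _ IH2|//|w w' _ ->//|].
- rewrite /eval_word !big_cons big_nil /= mulg1.
  by case: b; rewrite ?mulgV ?mulVg.
- by rewrite !eval_cat IH1 IH2.
- by move=> w w' w'' _ -> _ ->.
Qed.

Definition pres_lift (x : presented) : G := eval_word (repr x).

Lemma pres_lift_pi w : pres_lift (\pi w) = eval_word w.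
Proof. exact/esym/eval_presEq/repr_pres. Qed.

Lemma pres_lift_gen x : pres_lift (pgen x) = f x.
Proof. by rewrite pres_lift_pi /eval_word big_seq1. Qed.

Lemma pres_liftM : {morph pres_lift : x y / x * y}.
Proof.
move=> x y; elim/presented_ind: x => x; elim/presented_ind: y => y.
rewrite -pi_pres_rcat !pres_lift_pi.
exact: eval_cat.
Qed.

Lemma pres_lift1 : pres_lift 1 = 1.
Proof. by rewrite pres_lift_pi /eval_word big_nil. Qed.

Lemma pres_liftV : {morph pres_lift : x / x^-1}.
Proof.
move=> x; apply: (mulIg (pres_lift x)).
by rewrite -pres_liftM !mulVg pres_lift1.
Qed.

End Lift.

Lemma pres_ind (P : presented -> Prop) :
  P 1 -> (forall x, P (pgen x)) -> (forall x, P x -> P x^-1) ->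
  (forall x y, P x -> P y -> P (x * y)) -> forall x, P x.
Proof.
move=> P1 Pg PV PM x; rewrite -[x]reprK; elim: (repr x) => [//|[y b] w IHw].
rewrite -cat1s pi_pres_rcat; apply: PM => //; case: b; first exact: Pg.
have -> : \pi_presented [:: (y, false)] = (pgen y)^-1.
  exact: (pi_pres_inv [:: (y, true)]).
exact/PV/Pg.
Qed.

Lemma pres_hom_eq (G : groupType) (f g : presented -> G) :
  {morph f : x y / x * y} -> {morph g : x y / x * y} ->
  (forall x, f (pgen x) = g (pgen x)) -> f =1 g.
Proof.
move=> fM gM fg; have f1 : f 1 = g 1.
  by apply: (mulgI (f 1)); rewrite -fM mulg1; apply: (mulIg (g 1));
     rewrite -mulgA -gM mulg1.
have e1 (k : presented -> G) : {morph k : x y / x * y} -> k 1 = 1.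
  by move=> kM; apply: (mulgI (k 1)); rewrite -kM !mulg1.
apply: pres_ind => // [x xE|x y xE yE]; last by rewrite fM gM xE yE.
by apply: (mulIg (f x)); rewrite -fM xE -gM !mulVg.
Qed.

End Presented.

Section PresentedAction.
Variables (X : choiceType) (R : word X -> word X -> Prop) (Gam : groupType).
Variable to : Gam -> X -> X.
Hypothesis to1 : forall x, to 1 x = x.
Hypothesis toM : forall a b x, to (a * b) x = to a (to b x).
Hypothesis toR : forall a w w', R w w' ->
  R [seq (to a z.1, z.2) | z <- w] [seq (to a z.1, z.2) | z <- w'].

Lemma eval_pgen a w : eval_word (fun x => pgen R (to a x)) w =
  \pi_(presented R) [seq (to a z.1, z.2) | z <- w].
Proof.
elim: w => [|[x b] w IHw]; first by rewrite /eval_word big_nil.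
rewrite -cat1s eval_cat map_cat pi_pres_rcat IHw /eval_word big_seq1 /=.
by congr (_ * _); case: b => //; rewrite (pi_pres_inv _ [:: (to a x, true)]).
Qed.

Lemma pres_act_rel a w w' : R w w' ->
  eval_word (fun x => pgen R (to a x)) w = eval_word (fun x => pgen R (to a x)) w'.
Proof.
by move=> h; rewrite !eval_pgen; apply/presP/PresRel/toR.
Qed.

Definition pres_act (a : Gam) : presented R -> presented R :=
  pres_lift (fun x => pgen R (to a x)).

Lemma pres_act_gen a x : pres_act a (pgen R x) = pgen R (to a x).
Proof. exact/pres_lift_gen/pres_act_rel. Qed.

Lemma pres_act_morph a : {morph pres_act a : x y / x * y}.
Proof. exact/pres_liftM/pres_act_rel. Qed.

Lemma pres_act1 x : pres_act 1 x = x.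
Proof.
apply: (pres_hom_eq (f := pres_act 1) (g := id)) => //.
  exact: pres_act_morph.
by move=> y; rewrite pres_act_gen to1.
Qed.

Lemma pres_actM a b x : pres_act (a * b) x = pres_act a (pres_act b x).
Proof.
apply: (pres_hom_eq (f := pres_act (a * b)) (g := pres_act a \o pres_act b)).
- exact: pres_act_morph.
- by move=> y z /=; rewrite !pres_act_morph.
- by move=> y /=; rewrite !pres_act_gen toM.
Qed.

Definition presAction : autAction Gam (presented R) :=
  AutAction pres_act1 pres_actM pres_act_morph.

End PresentedAction.

Section Radical.
Variable A : nzRingType.
Local Open Scope ring_scope.

(* idealr_closed is a proper ideal for left multiplication: it contains 0, is
   closed under a * u + v, and does not contain 1. *)
Definition maxLeftIdeal (M : {pred A}) : Prop :=
  idealr_closed M /\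
  forall I : {pred A}, idealr_closed I -> {subset M <= I} -> {subset I <= M}.

Definition local_ring : Prop :=
  (exists M : {pred A}, maxLeftIdeal M) /\
  (forall M N : {pred A}, maxLeftIdeal M -> maxLeftIdeal N -> M =i N).

Definition jacobson : {pred A} :=
  fun x => `[< forall M : {pred A}, maxLeftIdeal M -> x \in M >].

Lemma jacobsonB x y : x \in jacobson -> y \in jacobson -> x - y \in jacobson.
Proof.
move=> /asboolP xP /asboolP yP; apply/asboolP => M Mmax.
have [[_ _ Mlin] _] := Mmax.
by rewrite addrC -mulN1r; apply: Mlin; [exact: yP | exact: xP].
Qed.

Lemma jacobson0 : 0 \in jacobson.
Proof. by apply/asboolP => M [[M0 _ _] _]. Qed.

Lemma jacobson_mull a x : x \in jacobson -> a * x \in jacobson.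
Proof.
move=> /asboolP xP; apply/asboolP => M Mmax.
have [[M0 _ Mlin] _] := Mmax.
by rewrite -[a * x]addr0; apply: Mlin; [exact: xP | exact: M0].
Qed.

Lemma jacobson_mulr a x : x \in jacobson -> x * a \in jacobson.
Proof.
move=> /asboolP xP; apply/asboolP => M Mmax.
have [[M0 M1 Mlin] Mm] := Mmax.
have MD u v : u \in M -> v \in M -> u + v \in M.
  by move=> uM vM; rewrite -[u]mul1r; exact: Mlin.
have Ml b u : u \in M -> b * u \in M.
  by move=> uM; rewrite -[b * u]addr0; exact: Mlin.
case: (boolP (a \in M)) => [aM|aNM]; first exact: Ml.
pose K : {pred A} := [pred b | b * a \in M].
suff KM : maxLeftIdeal K by exact: (xP K KM).
split.
  split; first by rewrite inE mul0r.
    by rewrite inE mul1r.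
  by move=> b u v; rewrite !inE => uK vK; rewrite mulrDl -mulrA; exact: Mlin.
move=> I [I0 I1 Ilin] KI b bI; rewrite inE; apply: contraT => baNM.
(* J = M + A b a contains M strictly, hence contains 1. *)
pose J : {pred A} := fun z => `[< exists c, z - c * (b * a) \in M >].
have MJ : {subset M <= J}.
  by move=> z zM; apply/asboolP; exists 0; rewrite mul0r subr0.
have Jlin c : {in J &, forall u v, c * u + v \in J}.
  move=> u v /asboolP[d dP] /asboolP[e eP]; apply/asboolP; exists (c * d + e).
  rewrite mulrDl opprD addrACA -mulrA -mulrBr; exact: Mlin.
have J1 : 1 \in J.
  apply: contraT => J1; case/negP: baNM.
  apply: (Mm J) => //; first by split => //; exact: MJ.
  by apply/asboolP; exists 1; rewrite mul1r subrr.
have [|c cP] := asboolP _ (_ : a \in J).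
  by rewrite -[a]mulr1 -[a * 1]addr0; apply: Jlin => //; exact: MJ.
case/negP: I1; rewrite -(subrK (c * b) 1) addrC; apply: Ilin => //.
by apply: KI; rewrite inE mulrBl mul1r -mulrA.
Qed.

Definition jac_rel (x y : A) : bool := x - y \in jacobson.

Lemma jac_rel_refl : reflexive jac_rel.
Proof. by move=> x; rewrite /jac_rel subrr jacobson0. Qed.

Lemma jacobsonN x : x \in jacobson -> - x \in jacobson.
Proof. by move=> xJ; rewrite -sub0r; exact: jacobsonB jacobson0 xJ. Qed.

Lemma jacobsonD x y : x \in jacobson -> y \in jacobson -> x + y \in jacobson.
Proof. by move=> xJ yJ; rewrite -[y]opprK; exact: jacobsonB xJ (jacobsonN yJ). Qed.

Lemma jac_rel_sym : symmetric jac_rel.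
Proof.
by move=> x y; apply/idP/idP => /jacobsonN; rewrite opprB.
Qed.

Lemma jac_rel_trans : transitive jac_rel.
Proof.
by move=> y x z xy yz; rewrite /jac_rel -(subrKA y); exact: jacobsonD.
Qed.

Canonical jac_equiv := EquivRel jac_rel jac_rel_refl jac_rel_sym jac_rel_trans.

Definition residue := {eq_quot jac_equiv}.

HB.instance Definition _ : EqQuotient _ jac_equiv residue := EqQuotient.on residue.
HB.instance Definition _ := Choice.on residue.

Lemma resP (x y : A) :
  reflect (\pi_residue x = \pi_residue y) (x - y \in jacobson).
Proof. by apply: (iffP idP) => [xy|/eqmodP//]; apply/eqmodP. Qed.

Definition res_zero : residue := \pi_residue (0 : A).
Definition res_one : residue := \pi_residue (1 : A).
Definition res_opp (x : residue) : residue := \pi_residue (- (repr x : A)).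
Definition res_add (x y : residue) : residue :=
  \pi_residue ((repr x : A) + (repr y : A)).
Definition res_mul (x y : residue) : residue :=
  \pi_residue ((repr x : A) * (repr y : A)).

Lemma repr_res x : x - repr (\pi_residue x) \in jacobson.
Proof. by apply/resP; rewrite reprK. Qed.

Lemma pi_res_opp x : \pi_residue (- x) = res_opp (\pi_residue x).
Proof. by apply/resP; rewrite -opprD; exact/jacobsonN/repr_res. Qed.

Lemma pi_res_add x y :
  \pi_residue (x + y) = res_add (\pi_residue x) (\pi_residue y).
Proof.
by apply/resP; rewrite opprD addrACA; apply: jacobsonD; exact: repr_res.
Qed.

Lemma pi_res_mul x y :
  \pi_residue (x * y) = res_mul (\pi_residue x) (\pi_residue y).
Proof.
apply/resP; set a := repr (\pi_residue x); set b := repr (\pi_residue y).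
rewrite -(subrKA (a * y)) -mulrBl -mulrBr; apply: jacobsonD.
  by apply: jacobson_mulr; exact: repr_res.
by apply: jacobson_mull; exact: repr_res.
Qed.

Lemma residue_ind (P : residue -> Prop) :
  (forall x : A, P (\pi_residue x)) -> forall x, P x.
Proof. by move=> h x; rewrite -[x]reprK; exact: h. Qed.

Lemma res_addA : associative res_add.
Proof.
move=> x y z; elim/residue_ind: x => x; elim/residue_ind: y => y.
by elim/residue_ind: z => z; rewrite -!pi_res_add addrA.
Qed.

Lemma res_addC : commutative res_add.
Proof.
move=> x y; elim/residue_ind: x => x; elim/residue_ind: y => y.
by rewrite -!pi_res_add addrC.
Qed.

Lemma res_add0 : left_id res_zero res_add.
Proof. by move=> x; elim/residue_ind: x => x; rewrite -pi_res_add add0r. Qed.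

Lemma res_addN : left_inverse res_zero res_opp res_add.
Proof.
by move=> x; elim/residue_ind: x => x; rewrite -pi_res_opp -pi_res_add addNr.
Qed.

HB.instance Definition _ :=
  GRing.isZmodule.Build residue res_addA res_addC res_add0 res_addN.

Lemma res_mulA : associative res_mul.
Proof.
move=> x y z; elim/residue_ind: x => x; elim/residue_ind: y => y.
by elim/residue_ind: z => z; rewrite -!pi_res_mul mulrA.
Qed.

Lemma res_mul1 : left_id res_one res_mul.
Proof. by move=> x; elim/residue_ind: x => x; rewrite -pi_res_mul mul1r. Qed.

Lemma res_1mul : right_id res_one res_mul.
Proof. by move=> x; elim/residue_ind: x => x; rewrite -pi_res_mul mulr1. Qed.

Lemma res_mulDl : left_distributive res_mul res_add.
Proof.
move=> x y z; elim/residue_ind: x => x; elim/residue_ind: y => y.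
elim/residue_ind: z => z.
by rewrite -pi_res_add -!pi_res_mul -pi_res_add mulrDl.
Qed.

Lemma res_mulDr : right_distributive res_mul res_add.
Proof.
move=> x y z; elim/residue_ind: x => x; elim/residue_ind: y => y.
elim/residue_ind: z => z.
by rewrite -pi_res_add -!pi_res_mul -pi_res_add mulrDr.
Qed.

HB.instance Definition _ := GRing.Zmodule_isPzRing.Build residue
  res_mulA res_mul1 res_1mul res_mulDl res_mulDr.

End Radical.

Definition ring_isomorphic (R S : pzRingType) : Prop :=
  exists f : {rmorphism R -> S}, bijective f.

Definition units (A : unitRingType) := {x : A | x \is a GRing.unit}.

Section Units.
Variable A : unitRingType.
Local Open Scope ring_scope.

HB.instance Definition _ := SubChoice.on (units A).

Lemma units_mul_subproof (u v : units A) : val u * val v \is a GRing.unit.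
Proof. by rewrite unitrMl (valP u, valP v). Qed.

Lemma units_inv_subproof (u : units A) : (val u)^-1 \is a GRing.unit.
Proof. by rewrite unitrV (valP u). Qed.

Definition units_one : units A :=
  exist (fun x => x \is a GRing.unit) 1 (unitr1 A).
Definition units_mul (u v : units A) : units A :=
  exist (fun x => x \is a GRing.unit) _ (units_mul_subproof u v).
Definition units_inv (u : units A) : units A :=
  exist (fun x => x \is a GRing.unit) _ (units_inv_subproof u).

Lemma units_mulA : associative units_mul.
Proof. by move=> u v w; apply: val_inj; rewrite /= mulrA. Qed.

Lemma units_mul1 : left_id units_one units_mul.
Proof. by move=> u; apply: val_inj; rewrite /= mul1r. Qed.

Lemma units_1mul : right_id units_one units_mul.
Proof. by move=> u; apply: val_inj; rewrite /= mulr1. Qed.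

Lemma units_mulV : left_inverse units_one units_inv units_mul.
Proof. by move=> u; apply: val_inj; rewrite /= mulVr // (valP u). Qed.

Lemma units_Vmul : right_inverse units_one units_inv units_mul.
Proof. by move=> u; apply: val_inj; rewrite /= mulrV // (valP u). Qed.

HB.instance Definition _ :=
  isGroup.Build (units A) units_mulA units_mul1 units_1mul units_mulV units_Vmul.

End Units.

Section SymbolGroups.
Variable A : unitRingType.
Local Notation Au := (units A).
Local Notation "<< u , v >>" := ((u, v), true) (only parsing).

Definition conj_pair (a : Au) (x : Au * Au) : Au * Au :=
  (conj_act a x.1, conj_act a x.2).

Lemma conj_pair1 x : conj_pair 1 x = x.
Proof. by case: x => u v; rewrite /conj_pair !conj_act1. Qed.

Lemma conj_pairM a b x : conj_pair (a * b) x = conj_pair a (conj_pair b x).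
Proof. by rewrite /conj_pair !conj_actM. Qed.

(* The condition u != 1, 1 - u \in A^* is expressed with a unit v equal to 1 - u. *)
Definition steinberg_pair (u v : Au) : Prop := u != 1 /\ val v = (1 - val u)%R.

Lemma conj_steinberg a u v :
  steinberg_pair u v -> steinberg_pair (conj_act a u) (conj_act a v).
Proof.
case=> u1 uv; split.
  apply: contra_neq u1 => h.
  have : conj_act a^-1 (conj_act a u) = 1 by rewrite h /conj_act mulg1 mulgV.
  by rewrite -conj_actM mulVg conj_act1.
rewrite /= uv mulrBr mulr1 mulrBl mulrV ?(valP a) //.
Qed.

Inductive symRel : word (Au * Au)%type -> word (Au * Au)%type -> Prop :=
| SymSteinberg u v of steinberg_pair u v : symRel [:: <<u, v>>] [::]
| SymMulL u u' v : symRel [:: <<u * u', v>>] [:: <<u, v>>; <<u', v>>]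
| SymMulR u v v' : symRel [:: <<u, v * v'>>] [:: <<u, v>>; <<u, v'>>].

Inductive URel : word (Au * Au)%type -> word (Au * Au)%type -> Prop :=
| USteinberg u v of steinberg_pair u v : URel [:: <<u, v>>] [::]
| UMulL u v w : URel [:: <<u * v, w>>]
    [:: <<u * v * u^-1, u * w * u^-1>>; <<u, w>>]
| UCyclic u v w : URel [:: <<u, v * w>>; <<v, w * u>>; <<w, u * v>>] [::].

Lemma conj_symRel a w w' : symRel w w' ->
  symRel [seq (conj_pair a z.1, z.2) | z <- w]
         [seq (conj_pair a z.1, z.2) | z <- w'].
Proof.
case=> [u v uv|u u' v|u v v'] /=; rewrite /conj_pair /= ?conj_act_morph.
- exact/SymSteinberg/conj_steinberg.
- exact: SymMulL.
- exact: SymMulR.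
Qed.

Lemma conj_URel a w w' : URel w w' ->
  URel [seq (conj_pair a z.1, z.2) | z <- w]
       [seq (conj_pair a z.1, z.2) | z <- w'].
Proof.
have cV u : conj_act a u^-1 = (conj_act a u)^-1.
  by rewrite /conj_act !invgM invgK mulgA.
case=> [u v uv|u v w1|u v w1] /=; rewrite /conj_pair /= ?conj_act_morph ?cV.
- exact/USteinberg/conj_steinberg.
- exact: UMulL.
- exact: UCyclic.
Qed.

Definition SymA : groupType := presented symRel.
Definition UA : groupType := presented URel.

Definition sym_gen (u v : Au) : SymA := pgen symRel (u, v).
Definition U_gen (u v : Au) : UA := pgen URel (u, v).

Definition sym_act : autAction Au SymA :=
  presAction conj_pair1 conj_pairM conj_symRel.
Definition U_act : autAction Au UA :=
  presAction conj_pair1 conj_pairM conj_URel.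

Lemma sym_act_gen a u v :
  sym_act a (sym_gen u v) = sym_gen (a * u * a^-1) (a * v * a^-1).
Proof. exact: pres_act_gen conj_symRel a (u, v). Qed.

Lemma U_act_gen a u v : U_act a (U_gen u v) = U_gen (a * u * a^-1) (a * v * a^-1).
Proof. exact: pres_act_gen conj_URel a (u, v). Qed.

Definition SymCoinv : groupType := coinv (wholeGroup sym_act).

Lemma tauR w w' : URel w w' ->
  eval_word (fun x : Au * Au => x.1 * x.2 * x.1^-1 * x.2^-1) w =
  eval_word (fun x : Au * Au => x.1 * x.2 * x.1^-1 * x.2^-1) w'.
Proof.
case=> [u v [_ uv]|u v x|u v x]; rewrite /eval_word !big_cons big_nil /=.
- rewrite mulg1; have -> : u * v = v * u; last by rewrite mulgK mulgV.
  by apply: val_inj; rewrite /= uv mulrBr mulrBl mulr1 mul1r.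
- by rewrite !(invgM, invgK, mulgA, mulg1, mulgVK, mulgK).
- by rewrite !(invgM, invgK, mulgA, mulg1, mulgVK, mulgK, mulgV).
Qed.

(* The homomorphism U(A) -> A^* taking <<u, v>> to u v u^-1 v^-1; its image is
   [A^*, A^*]. *)
Definition tau : UA -> Au :=
  pres_lift (fun x : Au * Au => x.1 * x.2 * x.1^-1 * x.2^-1).

Lemma tau_gen u v : tau (U_gen u v) = u * v * u^-1 * v^-1.
Proof. exact: (pres_lift_gen tauR (u, v)). Qed.

Lemma tauM : {morph tau : x y / x * y}.
Proof. exact: (pres_liftM tauR). Qed.

Lemma tau1 : tau 1 = 1.
Proof. exact: (pres_lift1 tauR). Qed.

Lemma tauV : {morph tau : x / x^-1}.
Proof. exact: (pres_liftV tauR). Qed.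

Lemma tau_act a x : tau (U_act a x) = a * tau x * a^-1.
Proof.
apply: (pres_hom_eq (f := fun x => tau (U_act a x))
                    (g := fun x => conj_act a (tau x))).
- by move=> y z; rewrite act_morph tauM.
- by move=> y z; rewrite tauM conj_act_morph.
- case=> u v; rewrite -/(U_gen u v) U_act_gen !tau_gen.
  by rewrite /conj_act !(invgM, invgK, mulgA, mulgVK).
Qed.

Lemma tau_comm x : tau x \in @commSub Au.
Proof.
elim/pres_ind: x => [|[u v]|x xC|x y xC yC].
- by rewrite tau1 gpred1.
- by rewrite -/(U_gen u v) tau_gen mem_commSub.
- by rewrite tauV gpredV.
- by rewrite tauM gpredM.
Qed.

Definition tauImage : {pred Au} := fun g => `[< exists x, tau x = g >].

Lemma tauImageM : mulg_closed tauImage.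
Proof.
by move=> _ _ /asboolP[x <-] /asboolP[y <-]; apply/asboolP; exists (x * y); rewrite tauM.
Qed.

Lemma tauImage1 : 1 \in tauImage.
Proof. by apply/asboolP; exists 1; rewrite tau1. Qed.

Lemma tauImageV : invg_closed tauImage.
Proof. by move=> _ /asboolP[x <-]; apply/asboolP; exists x^-1; rewrite tauV. Qed.

HB.instance Definition _ := isMulClosed.Build Au tauImage tauImageM.
HB.instance Definition _ := isMul1Closed.Build Au tauImage tauImage1.
HB.instance Definition _ := isInvClosed.Build Au tauImage tauImageV.

Lemma tau_surj g : g \in @commSub Au -> exists x, tau x = g.
Proof.
move=> /asboolP gP; apply/asboolP; apply: (gP tauImage) => u v.
by apply/asboolP; exists (U_gen u v); rewrite tau_gen.
Qed.

(* K_2(A) is identified with Ker tau through Guin's exact sequence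
   0 -> K_2(A) -> U(A) -> [A^*, A^*] -> e. *)
Definition K2 : {pred UA} := fun x => tau x == 1.

Lemma K2M : mulg_closed K2.
Proof.
by move=> x y; rewrite !unfold_in => /eqP xK /eqP yK; rewrite tauM xK yK mulg1.
Qed.

Lemma K21 : 1 \in K2.
Proof. by rewrite unfold_in tau1. Qed.

Lemma K2V : invg_closed K2.
Proof. by move=> x; rewrite !unfold_in => /eqP xK; rewrite tauV xK invg1. Qed.

HB.instance Definition _ := isMulClosed.Build UA K2 K2M.
HB.instance Definition _ := isMul1Closed.Build UA K2 K21.
HB.instance Definition _ := isInvClosed.Build UA K2 K2V.

Lemma K2_stable a x : x \in K2 -> U_act a x \in K2.
Proof. by rewrite !unfold_in => /eqP xK; rewrite tau_act xK mulg1 mulgV. Qed.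

Definition K2sub : stableSubgroup U_act :=
  StableSubgroup (to := U_act) (ssub := K2) K2_stable.

Definition tauPreim : {pred UA} := fun x => tau x \in gammaSub (commStable Au).

Lemma tauPreimE x : (x \in tauPreim) = (tau x \in gammaSub (commStable Au)).
Proof. by []. Qed.

Lemma tauPreimM : mulg_closed tauPreim.
Proof. by move=> x y; rewrite !tauPreimE tauM; exact: gammaSubM. Qed.

Lemma tauPreim1 : 1 \in tauPreim.
Proof. by rewrite tauPreimE tau1; exact: gammaSub1. Qed.

Lemma tauPreimV : invg_closed tauPreim.
Proof. by move=> x; rewrite !tauPreimE tauV; exact: gammaSubV. Qed.

HB.instance Definition _ := isMulClosed.Build UA tauPreim tauPreimM.
HB.instance Definition _ := isMul1Closed.Build UA tauPreim tauPreim1.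
HB.instance Definition _ := isInvClosed.Build UA tauPreim tauPreimV.

(* tau restricts to Gamma(tau) : Gamma U(A) -> Gamma [A^*, A^*]. *)
Lemma tau_gammaSub x :
  x \in gammaSub (wholeGroup U_act) -> tau x \in gammaSub (commStable Au).
Proof.
move=> /asboolP xP; suff : x \in tauPreim by [].
apply: xP => [a y _|y z _]; rewrite !tauPreimE !tauM tauV ?tau_act.
  by apply/asboolP => N N1 _; exact: N1 (tau_comm y).
by move=> zP; apply: gammaSub_norm => //; exact: tau_comm.
Qed.

(* Ker Gamma(tau): the elements of Gamma U(A) killed by tau. *)
Definition kerGammaTau : {pred UA} :=
  fun x => (x \in gammaSub (wholeGroup U_act)) && (tau x == 1).

Lemma kerGammaTauM : mulg_closed kerGammaTau.
Proof.
move=> x y /andP[xG xK] /andP[yG yK]; apply/andP; split; first exact: gpredM.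
exact: (K2M xK yK).
Qed.

Lemma kerGammaTau1 : 1 \in kerGammaTau.
Proof. by apply/andP; split; [exact: gpred1 | exact: K21]. Qed.

Lemma kerGammaTauV : invg_closed kerGammaTau.
Proof.
move=> x /andP[xG xK]; apply/andP; split; first by rewrite gpredV.
exact: (K2V xK).
Qed.

HB.instance Definition _ := isMulClosed.Build UA kerGammaTau kerGammaTauM.
HB.instance Definition _ := isMul1Closed.Build UA kerGammaTau kerGammaTau1.
HB.instance Definition _ := isInvClosed.Build UA kerGammaTau kerGammaTauV.

Lemma gammaK2_sub : {subset gammaSub K2sub <= kerGammaTau}.
Proof.
move=> x xK; apply/andP; split; last exact: (gammaSub_sub xK).
move/asboolP: xK; apply=> [a y _|h y _ yG].
  by apply/asboolP => N N1 _; exact: N1.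
by rewrite gammaSub_norm.
Qed.

Lemma gammaK2_norm h x :
  h \in kerGammaTau -> x \in gammaSub K2sub -> h * x * h^-1 \in gammaSub K2sub.
Proof. by case/andP=> _ hK; exact: gammaSub_norm. Qed.

Definition gammaK2 : normalSubgroup kerGammaTau :=
  NormalSubgroup (H := kerGammaTau) (nsub := gammaSub K2sub) gammaK2_sub gammaK2_norm.

End SymbolGroups.

Arguments K2 A : clear implicits.
Arguments kerGammaTau A : clear implicits.

Definition exact_at (G H K : groupType) (f : G -> H) (g : H -> K) : Prop :=
  forall y, g y = 1 <-> exists x, f x = y.

(* Main.v *)
(** U(A) is a crossed module over A^*: [tau y] acts on U(A) as conjugation by
    [y].  Hence U(A) modulo Gamma U(A) is abelian, and bimultiplicative on
    generators.  Conversely, when A is local with residue ring other than F_2,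
    Sym(A) is abelian and its symbol is antisymmetric, so the cyclic relation
    of U(A) holds in the coinvariants of Sym(A).  Thus U(A) / Gamma U(A) and
    Sym^{A^*}(A) are canonically isomorphic, and the sequence is obtained by
    taking coinvariants in K_2(A) -> U(A) -> [A^*, A^*]; its exactness follows
    from the surjectivity of Gamma(tau). *)
Require Import Defs.
From HB Require Import structures.
From mathcomp Require Import all_boot all_order all_algebra.
From mathcomp Require Import boolp.
From mathcomp Require classical_sets.

Set Implicit Arguments.
Unset Strict Implicit.
Unset Printing Implicit Defensive.

Import GRing.Theory.

Local Open Scope quotient_scope.
Local Open Scope group_scope.

(** * Multiplicative maps between groups *)

Section GroupMorphism.
Variables (G K : groupType) (phi : G -> K).
Hypothesis phiM : {morph phi : x y / x * y}.

Lemma morph_group1 : phi 1 = 1.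
Proof. by apply: (mulgI (phi 1)); rewrite -phiM !mulg1. Qed.

Lemma morph_groupV : {morph phi : x / x^-1}.
Proof.
by move=> x; apply: (mulgI (phi x)); rewrite -phiM !mulgV morph_group1.
Qed.

Lemma morph_groupF : {morph phi : x y / x / y}.
Proof. by move=> x y; rewrite phiM morph_groupV. Qed.

Lemma morph_group_inj : (forall x, phi x = 1 -> x = 1) -> injective phi.
Proof.
by move=> ker x y e; apply/divg1_eq/ker; rewrite morph_groupF e mulgV.
Qed.

End GroupMorphism.

(** * Quotients and their universal property *)

Section QuotientMaps.
Variables (G : groupType) (H : groupClosed G) (N : normalSubgroup H).

Lemma cosetE (x : subg H) : coset N (val x) = \pi_(quo N) x.
Proof. by rewrite /coset valKd. Qed.

Lemma coset_surj (y : quo N) : exists2 x, x \in H & coset N x = y.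
Proof.
by elim/quo_ind: y => x; exists (val x); [exact: valP | exact: cosetE].
Qed.

Lemma cosetM : {in H &, {morph coset N : x y / x * y}}.
Proof.
move=> x y xH yH; have h z (zH : z \in H) : coset N z = \pi_(quo N) (Sub z zH).
  by rewrite -cosetE SubK.
rewrite (h _ xH) (h _ yH) (h _ (gpredM _ _ xH yH)).
rewrite -[RHS](@pi_quo_mul _ _ N); congr (\pi_(quo N) _).
by apply: val_inj; rewrite valM !SubK.
Qed.

Lemma coset_eq1 x : x \in H -> coset N x = 1 <-> x \in N.
Proof.
move=> xH; rewrite -[x](SubK (subg H) xH) cosetE; split.
  by move/quoP; rewrite val1 divg1.
by move=> xN; apply/quoP; rewrite val1 divg1.
Qed.

Lemma quo_lift (K : groupType) (phi : G -> K) :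
  {in H &, {morph phi : x y / x * y}} -> {in N, forall x, phi x = 1} ->
  exists F : {multiplicative quo N -> K}, {in H, forall x, F (coset N x) = phi x}.
Proof.
(* [F] is read off the chosen representative; any other one differs from it by an element of [N],
   which [phi] kills. *)
move=> phiM phi1; pose F (y : quo N) : K := phi (val (repr y : subg H)).
have FE : {in H, forall x, F (coset N x) = phi x}.
  move=> x xH; rewrite -[x](SubK (subg H) xH) cosetE /F.
  set a : subg H := Sub x xH; set b : subg H := repr _.
  have /quoP abN : \pi_(quo N) b = \pi_(quo N) a by rewrite reprK.
  have bH := valP b; have aH := valP a.
  rewrite -[val b](divgK (val a)) phiM ?(phi1 _ abN) ?mul1g //.
  exact: gpredF.
have FM : {morph F : x y / x * y}.
  move=> y z; have [x xH <-] := coset_surj y; have [x' xH' <-] := coset_surj z.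
  by rewrite -cosetM ?FE ?phiM ?gpredM.
pose m := isMultiplicative.Build _ _ F FM.
pose f : {multiplicative quo N -> K} := HB.pack F m.
by exists f.
Qed.

End QuotientMaps.

(** * Coinvariants and their universal property *)

Section Coinvariants.
Variables (Gam G : groupType) (to : autAction Gam G) (H : stableSubgroup to).

Lemma mem_gammaSub a x : x \in H -> to a x * x^-1 \in gammaSub H.
Proof. by move=> xH; apply/asboolP => N N1 _; exact: N1. Qed.

Lemma coinv_surj (y : coinv H) : exists2 x, x \in H & coinv_class H x = y.
Proof. exact: coset_surj. Qed.

Lemma coinv_classM : {in H &, {morph coinv_class H : x y / x * y}}.
Proof. exact: cosetM. Qed.

Lemma coinv_class_eq1 x : x \in H -> coinv_class H x = 1 <-> x \in gammaSub H.
Proof. exact: coset_eq1. Qed.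

Lemma coinv_class_act a x : x \in H -> coinv_class H (to a x) = coinv_class H x.
Proof.
move=> xH; rewrite -[to a x](divgK x) coinv_classM ?gpredF ?ssub_stable //.
have /coinv_class_eq1 -> := mem_gammaSub a xH; first by rewrite mul1g.
by rewrite gpredF ?ssub_stable.
Qed.

(** The elements of [H] killed by [phi] form a subgroup, stable under conjugation by [H] and
    containing all [to a x * x^-1]; [gammaSub H] is the smallest such subgroup. *)
Lemma gammaSub_ker (K : groupType) (phi : G -> K) :
  {in H &, {morph phi : x y / x * y}} ->
  (forall a x, x \in H -> phi (to a x) = phi x) ->
  {in gammaSub H, forall x, phi x = 1}.
Proof.
move=> phiM phia.
have phi1 : phi 1 = 1.
  by apply: (mulgI (phi 1)); rewrite -phiM ?gpred1 // !mulg1.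
have phiV x : x \in H -> phi x^-1 = (phi x)^-1.
  by move=> xH; apply: (mulgI (phi x)); rewrite -phiM ?gpredV // !mulgV.
pose S : {pred G} := [pred x | (x \in H) && (phi x == 1)].
have SM : mulg_closed S.
  move=> x y /andP[xH /eqP x1] /andP[yH /eqP y1].
  by apply/andP; rewrite gpredM // phiM // x1 y1 mulg1.
have S1 : 1 \in S by apply/andP; rewrite gpred1 phi1.
have SV : invg_closed S.
  move=> x /andP[xH /eqP x1].
  by apply/andP; rewrite gpredV xH phiV // x1 invg1.
pose m1 := isMulClosed.Build G S SM; pose m2 := isMul1Closed.Build G S S1.
pose m3 := isInvClosed.Build G S SV.
pose N : groupClosed G := HB.pack S m1 m2 m3.
move=> x /asboolP xG; suff /andP[_ /eqP//] : x \in N.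
apply: xG => [a y yH|h y hH /andP[yH /eqP y1]]; apply/andP.
  by rewrite gpredF ?ssub_stable // phiM ?ssub_stable ?gpredV // phiV // phia // mulgV.
by rewrite !gpredM ?gpredV // !phiM ?gpredM ?gpredV // y1 mulg1 phiV // mulgV.
Qed.

Lemma coinv_lift (K : groupType) (phi : G -> K) :
  {in H &, {morph phi : x y / x * y}} ->
  (forall a x, x \in H -> phi (to a x) = phi x) ->
  exists F : {multiplicative coinv H -> K},
    {in H, forall x, F (coinv_class H x) = phi x}.
Proof. by move=> phiM phia; apply: quo_lift => //; exact: gammaSub_ker. Qed.

End Coinvariants.

(** * Units and residue ring of a local ring *)

Section LocalRing.
Variables (A : unitRingType) (Aloc : local_ring A).
Local Open Scope ring_scope.

(** Zorn's lemma for the proper left ideals containing [I], ordered by inclusion. *)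
Lemma proper_ideal_sub_max (I : {pred A}) : idealr_closed I ->
  exists2 M, maxLeftIdeal M & {subset I <= M}.
Proof.
move=> Iid; pose T := {J : {pred A} | idealr_closed J /\ {subset I <= J}}.
pose R : rel T := fun J K => `[< {subset sval J <= sval K} >].
pose t0 : T := exist _ I (conj Iid (fun x => id)).
have Rxx t : R t t by apply/asboolP.
have Rtr r s t : R r s -> R s t -> R r t.
  by move=> /asboolP rs /asboolP st; apply/asboolP => x /rs /st.
have [C totC|[M [Mid IM]] Mmax] := classical_sets.ZL_preorder t0 Rxx Rtr.
  (* The union of an empty chain is no ideal, so [I] itself bounds that chain. *)
  have [[c Cc]|noC] := pselect (exists c, C c); last first.
    by exists t0 => s Cs; case: noC; exists s.
  pose U : {pred A} := fun x => `[< exists2 J, C J & x \in sval J >].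
  have Uid : idealr_closed U.
    split.
    - by apply/asboolP; exists c => //; case: (svalP c) => -[].
    - by apply/asboolP => -[J _]; case: (svalP J) => -[_ /negPf ->].
    - move=> a u v /asboolP[J CJ uJ] /asboolP[K CK vK]; apply/asboolP.
      have [/asboolP JK|/asboolP KJ] := totC _ _ CJ CK.
        by exists K => //; case: (svalP K) => -[_ _ +] _; apply=> //; exact: JK.
      by exists J => //; case: (svalP J) => -[_ _ +] _; apply=> //; exact: KJ.
  have IU : {subset I <= U}.
    by move=> x xI; apply/asboolP; exists c => //; case: (svalP c) => _; apply.
  exists (exist _ U (conj Uid IU)) => s Cs; apply/asboolP => x xs.
  by apply/asboolP; exists s.
exists M => //; split=> // J Jid MJ.
have IJ : {subset I <= J} by move=> x /IM /MJ.
have /asboolP := Mmax (exist _ J (conj Jid IJ)) (asboolT MJ).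
exact.
Qed.

Lemma jacobson_max (M : {pred A}) : maxLeftIdeal M -> @jacobson A =i M.
Proof.
move=> Mmax x; apply/asboolP/idP => [|xM N Nmax]; first exact.
by rewrite (Aloc.2 _ _ Nmax Mmax).
Qed.

Lemma jacobsonF1 : 1 \notin @jacobson A.
Proof.
have [[M Mmax] _] := Aloc; rewrite (jacobson_max Mmax).
by case: Mmax => -[].
Qed.

(** Without a left inverse of [x], the left ideal A x would be proper, hence inside the unique
    maximal one, which is the radical. *)
Lemma left_inverse_notin_jacobson (x : A) :
  x \notin @jacobson A -> exists y, y * x = 1.
Proof.
move=> xJ; apply: contrapT => noy.
pose I : {pred A} := fun z => `[< exists y, z = y * x >].
have Iid : idealr_closed I.
  split.
  - by apply/asboolP; exists 0; rewrite mul0r.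
  - by apply/asboolP => -[y yx]; apply: noy; exists y.
  - move=> a _ _ /asboolP[u ->] /asboolP[v ->]; apply/asboolP.
    by exists (a * u + v); rewrite mulrDl mulrA.
have [M Mmax IM] := proper_ideal_sub_max Iid.
case/negP: xJ; rewrite (jacobson_max Mmax); apply: IM.
by apply/asboolP; exists 1; rewrite mul1r.
Qed.

(** The radical is two-sided and proper, so a left inverse [y] of [x] lies outside it and has a left
    inverse in turn, which must be [x]. *)
Lemma local_unitE (x : A) : (x \is a GRing.unit) = (x \notin @jacobson A).
Proof.
apply/idP/idP => [xU|xJ].
  apply: contra jacobsonF1 => xJ.
  by rewrite -(mulVr xU); exact: jacobson_mull.
have [y yx] := left_inverse_notin_jacobson xJ.
have yJ : y \notin @jacobson A.
  by apply: contra jacobsonF1 => yJ; rewrite -yx; exact: jacobson_mulr.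
have [z zy] := left_inverse_notin_jacobson yJ.
apply/unitrP; exists y; split=> //.
by rewrite -[x]mul1r -zy -(mulrA z) yx mulr1.
Qed.

Lemma local_unitD (x y : A) : x + y \is a GRing.unit ->
  (x \is a GRing.unit) || (y \is a GRing.unit).
Proof.
rewrite !local_unitE -negb_and; apply: contra => /andP[].
exact: jacobsonD.
Qed.

(** The residue ring has just the classes 0 and 1, distinct because 1 is not in the radical. The
    contrapositive will supply a unit a with 1 - a a unit. *)
Lemma residue_F2 :
  (forall x : A, (x \in @jacobson A) || (1 - x \in @jacobson A)) ->
  ring_isomorphic (residue A) 'F_2.
Proof.
move=> J01; have J1 : 1 \notin @jacobson A := jacobsonF1.
have pi1 (x : A) : x \notin @jacobson A -> \pi_(residue A) x = \pi_(residue A) 1.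
  move=> xJ; apply/esym/resP.
  by move: (J01 x); rewrite (negPf xJ).
have pi0 (x : A) : x \in @jacobson A -> \pi_(residue A) x = \pi_(residue A) 0.
  by move=> xJ; apply/resP; rewrite subr0.
have n01 : (\pi_(residue A) 1 == \pi_(residue A) 0) = false.
  by apply/negbTE; apply: contra J1 => /eqP/resP; rewrite subr0.
have res01 (r : residue A) : r = 0 \/ r = 1.
  elim/residue_ind: r => x.
  by case: (boolP (x \in @jacobson A)) => [/pi0|/pi1] ->; [left|right].
have F01 : (1 == 0 :> residue A) = false := n01.
have two : 1 + 1 = 0 :> residue A.
  case: (res01 (1 + 1)) => // /(canRL (addrK 1)); rewrite subrr => /eqP.
  by rewrite F01.
pose F (r : residue A) : 'F_2 := (r != 0)%:R.
have F0 : F 0 = 0 by rewrite /F eqxx.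
have F1 : F 1 = 1 by rewrite /F F01.
have FB : zmod_morphism F.
  have N1 : - 1 = 1 :> residue A by apply/esym/eqP; rewrite -addr_eq0 two.
  by move=> x y; case: (res01 x) => ->; case: (res01 y) => ->;
     rewrite ?subrr ?subr0 ?sub0r ?N1 ?F0 ?F1 ?subrr ?subr0 //; apply: val_inj.
have FM : monoid_morphism F.
  split=> // x y; case: (res01 x) => ->; case: (res01 y) => ->;
     by rewrite ?mul0r ?mulr0 ?mulr1 ?F0 ?F1 ?mul0r ?mulr0 ?mulr1.
pose m1 := GRing.isZmodMorphism.Build _ _ F FB.
pose m2 := GRing.isMonoidMorphism.Build _ _ F FM.
pose f : {rmorphism residue A -> 'F_2} := HB.pack F m1 m2.
exists f; exists (fun z : 'F_2 => (z != 0)%:R).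
  by move=> x; case: (res01 x) => -> /=; rewrite ?F0 ?F1.
by case=> -[|[|//]] i; apply: val_inj; rewrite /= /F ?eqxx ?F01.
Qed.

End LocalRing.

(** * Symbols in Sym(A) and their defect of antisymmetry *)

Section SymbolAntisymmetry.
Variable A : unitRingType.
Local Notation Au := (units A).
Local Notation "<< u , v >>" := (sym_gen u v).

Lemma sym_genMl (u u' v : Au) : << u * u', v >> = << u, v >> * << u', v >>.
Proof.
rewrite /sym_gen /pgen -pi_pres_rcat; apply/presP/PresRel; exact: SymMulL.
Qed.

Lemma sym_genMr (u v v' : Au) : << u, v * v' >> = << u, v >> * << u, v' >>.
Proof.
rewrite /sym_gen /pgen -pi_pres_rcat; apply/presP/PresRel; exact: SymMulR.
Qed.

(** If [u] were 1, the unit [v] would be 0; this yields the side condition of [steinberg_pair]. *)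
Lemma sym_gen_steinberg (u v : Au) : val v = (1 - val u)%R -> << u, v >> = 1.
Proof.
move=> uv; apply/presP/PresRel/SymSteinberg; split=> //.
apply: contraTneq (valP v) => u1.
by rewrite uv u1 subrr unitr0.
Qed.

Lemma sym_gen1l (v : Au) : << 1, v >> = 1.
Proof. by apply: (mulgI << 1, v >>); rewrite -sym_genMl !mulg1. Qed.

Lemma sym_gen1r (u : Au) : << u, 1 >> = 1.
Proof. by apply: (mulgI << u, 1 >>); rewrite -sym_genMr !mulg1. Qed.

Lemma sym_genVl (u v : Au) : << u^-1, v >> = << u, v >>^-1.
Proof. by apply: (mulgI << u, v >>); rewrite -sym_genMl !mulgV sym_gen1l. Qed.

Lemma sym_genVr (u v : Au) : << u, v^-1 >> = << u, v >>^-1.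
Proof. by apply: (mulgI << u, v >>); rewrite -sym_genMr !mulgV sym_gen1r. Qed.

(* Expand <<u u', v v'>> in the two possible orders. *)
Lemma sym_genC (u v u' v' : Au) : << u, v' >> * << u', v >> = << u', v >> * << u, v' >>.
Proof.
have := sym_genMl u u' (v * v'); rewrite sym_genMr !sym_genMl !sym_genMr.
by rewrite !mulgA => /mulIg; rewrite -!mulgA => /mulgI.
Qed.

Lemma symC (x y : SymA A) : x * y = y * x.
Proof.
have gC u v : forall y : SymA A, commute << u, v >> y.
  elim/pres_ind => [|[u' v']|z zC|z z' zC zC'].
  - exact: commute1.
  - exact: sym_genC.
  - exact: commuteV.
  - exact: commuteM.
suff : commute y x by [].
elim/pres_ind: x => [|[u v]|z zC|z z' zC zC'].
- exact: commute1.
- exact/commute_sym/gC.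
- exact: commuteV.
- exact: commuteM.
Qed.

Lemma symCA (x y z : SymA A) : x * (y * z) = y * (x * z).
Proof. by rewrite !mulgA (symC x). Qed.

Lemma symACA (x y z t : SymA A) : (x * y) * (z * t) = (x * z) * (y * t).
Proof. by rewrite -!mulgA (symCA y). Qed.

Definition opp1 : Au :=
  exist (fun x => x \is a GRing.unit) (- 1)%R (unitrN1 A).

Lemma opp1C u : opp1 * u = u * opp1.
Proof. by apply: val_inj; rewrite /= mulN1r mulrN1. Qed.

Lemma opp1K : opp1 * opp1 = 1.
Proof. by apply: val_inj; rewrite /= mulrNN mulr1. Qed.

Lemma opp1_invol u : opp1 * (opp1 * u) = u.
Proof. by rewrite mulgA opp1K mul1g. Qed.

(** The units to which the Steinberg relation applies; over a local ring the others are those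
    congruent to 1 modulo the radical. *)
Definition good (u : Au) : bool := (1 - val u)%R \is a GRing.unit.

Lemma goodV u : good u^-1 = good u.
Proof.
rewrite /good; have -> : (1 - val u = (val u) * - (1 - val u^-1%g))%R.
  by rewrite opprB mulrBr mulr1 /= mulrV // (valP u).
by rewrite unitrMr ?unitrN // (valP u).
Qed.

Lemma good_sqr (u : Au) : good u -> good (opp1 * u) -> good (u * u).
Proof.
move=> uG nuG; rewrite /good.
have -> : (1 - val (u * u)%g = (1 - val u) * (1 - val (opp1 * u)%g))%R.
  by rewrite /= mulN1r opprK mulrDr mulr1 mulrBl mul1r addrA subrK.
by rewrite unitrMl.
Qed.

(** [bsym] is the polar form of [qsym] and measures the failure of antisymmetry, which therefore
    reduces to the vanishing of [qsym]. *)
Definition qsym (u : Au) : SymA A := << u, opp1 * u >>.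
Definition bsym (u v : Au) : SymA A := << u, v >> * << v, u >>.

(** The entry -uv is split as (-u)v against u and as u(-v) against v. *)
Lemma qsymM u v : qsym (u * v) = qsym u * qsym v * bsym u v.
Proof.
have -> : qsym (u * v) = qsym u * << u, v >> * (<< v, u >> * qsym v).
  rewrite /qsym sym_genMl -!sym_genMr; congr (<< _, _ >> * << _, _ >>).
    by rewrite mulgA.
  by rewrite !mulgA opp1C.
by rewrite symACA -!mulgA; congr (_ * _); rewrite symCA (symC (qsym v)) -mulgA.
Qed.

Lemma bsymC u v : bsym u v = bsym v u.
Proof. exact: symC. Qed.

Lemma bsymMr u v w : bsym u (v * w) = bsym u v * bsym u w.
Proof. by rewrite /bsym sym_genMl sym_genMr symACA. Qed.

Lemma bsymMl u v w : bsym (u * v) w = bsym u w * bsym v w.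
Proof. by rewrite !(bsymC _ w) bsymMr. Qed.

Lemma bsym1r u : bsym u 1 = 1.
Proof. by rewrite /bsym sym_gen1l sym_gen1r mulg1. Qed.

Lemma bsym_steinberg (u v : Au) : val v = (1 - val u)%R -> bsym u v = 1.
Proof.
move=> uv; rewrite /bsym !sym_gen_steinberg ?mulg1 //.
by rewrite uv opprB addrC subrK.
Qed.

(* -u = (1 - u) (1 - u^-1)^-1 *)
Lemma qsym_good u : good u -> qsym u = 1.
Proof.
move=> uG; pose v : Au := exist (fun x => x \is a GRing.unit) _ uG.
have uV : good u^-1 by rewrite goodV.
pose w : Au := exist (fun x => x \is a GRing.unit) _ uV.
have -> : qsym u = << u, v * w^-1 >>.
  congr (<< _, _ >>); apply: (mulIg w); rewrite divgK.
  apply: val_inj; rewrite /= mulN1r mulrBr mulr1 mulNr mulrV ?(valP u) //.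
  by rewrite opprK addrC.
rewrite sym_genMr sym_genVr -sym_genVl !sym_gen_steinberg ?mulg1 //.
Qed.

End SymbolAntisymmetry.

(** * Antisymmetry of symbols over a local ring *)

Section SymbolAntisymmetryLocal.
Variables (A : unitRingType) (Aloc : local_ring A).
Hypothesis AF2 : ~ ring_isomorphic (residue A) 'F_2.
Local Notation Au := (units A).

Lemma exists_good : exists a : Au, good a.
Proof.
apply: contrapT => nog; apply/AF2/residue_F2 => // x.
apply: contraT; rewrite negb_or -!local_unitE // => /andP[xU x1U].
by case: nog; exists (exist (fun x => x \is a GRing.unit) x xU).
Qed.

(** In 1 - a = (1 - au) - a(1 - u) the left side is a unit and the last term is not, so locality
    makes 1 - au a unit. *)
Lemma good_mul (a u : Au) : good a -> ~~ good u -> good (a * u).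
Proof.
rewrite /good => aG uN.
have : (1 - val (a * u)%g + val a * - (1 - val u))%R \is a GRing.unit.
  by rewrite opprB mulrBr mulr1 addrA subrK.
case/local_unitD/orP=> //; rewrite unitrMr ?(valP a) // unitrN => uG.
by rewrite uG in uN.
Qed.

Lemma bad_mul (u v : Au) : ~~ good u -> ~~ good v -> ~~ good (u * v).
Proof.
move=> uN vN; apply: contra uN => uvG.
by rewrite -[u](mulgK v); apply: good_mul; rewrite ?goodV.
Qed.

Lemma bsym_good_bad (a u : Au) : good a -> ~~ good u -> bsym a u = (qsym u)^-1.
Proof.
move=> aG uN; apply: (mulgI (qsym u)); rewrite mulgV.
have := qsym_good (good_mul aG uN).
by rewrite qsymM (qsym_good aG) mul1g.
Qed.

(** As [a * a] is good, [bsym (a * a) u] is [(qsym u)^-1]; by multiplicativity it is also the square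
    of this element. *)
Lemma qsym_bad_sqr (a u : Au) : good a -> good (a * a) -> ~~ good u -> qsym u = 1.
Proof.
move=> aG aaG uN; have := bsym_good_bad aaG uN.
rewrite bsymMl !bsym_good_bad // -[RHS]mulg1 => /mulgI e.
by rewrite -[LHS]invgK e invg1.
Qed.

(* With -1 not congruent to 1, put t = -(1 + u): the Steinberg relation for
   the pair (-u, 1 + u) = (-u, -t) gives qsym u * qsym t = 1, its instance at
   u^-1 gives qsym u^-1 * qsym (t u^-1) = 1, and here qsym is multiplicative
   with values of order at most 2, so qsym t = 1. *)
Lemma qsym_bad_opp1 (u : Au) : (forall a : Au, good a -> ~~ good (a * a)) ->
  good (opp1 A) -> ~~ good u -> qsym u = 1.
Proof.
move=> nosq nG.
(* Since -1 is good, pairing [v] with (-1)(-1) = 1 gives the square of [(qsym v)^-1], so [qsym v]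
   has order at most 2. *)
have qV (v : Au) : ~~ good v -> (qsym v)^-1 = qsym v.
  move=> vN; apply: (mulgI (qsym v)); rewrite mulgV; apply/esym.
  have := bsym1r v; rewrite bsymC -(opp1K A) bsymMl !bsym_good_bad // -invgM.
  by move=> e; rewrite -[LHS]invgK e invg1.
have bq (v : Au) : ~~ good v -> bsym (opp1 A) v = qsym v.
  by move=> vN; rewrite bsym_good_bad // qV.
have qM (v w : Au) : ~~ good v -> ~~ good w -> qsym (v * w) = qsym v * qsym w.
  by move=> vN wN; rewrite -!bq ?bad_mul // bsymMr.
have b1 (v w : Au) : ~~ good v -> ~~ good w -> bsym v w = 1.
  move=> vN wN; apply: (mulgI (qsym v * qsym w)).
  by rewrite -qsymM qM // mulg1.
have bnn : bsym (opp1 A) (opp1 A) = 1.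
  by rewrite /bsym -sym_genMr opp1K sym_gen1r.
have key (v : Au) : ~~ good v -> exists2 t : Au, ~~ good t &
    val t = (- (1 + val v))%R /\ qsym v * qsym t = 1.
  move=> vN; have xG := good_mul nG vN.
  pose y : Au := exist (fun x => x \is a GRing.unit) _ xG.
  have yG : good y.
    by rewrite /good /= opprB addrC subrK mulN1r unitrN (valP v).
  have [t tE] : exists t, t = opp1 A * y by exists (opp1 A * y).
  (* Here y = 1 + v is good because 1 - y = -v; were t = -y good as well, [y * y] would be good,
     against [nosq]. *)
  have tN : ~~ good t.
    by apply: contra (nosq _ yG); rewrite tE; exact: good_sqr.
  exists t => //; split; first by rewrite tE /= !mulN1r opprK.
  have : bsym (opp1 A * v) (opp1 A * t) = 1.
    by apply: bsym_steinberg; rewrite tE opp1_invol.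
  by rewrite bsymMl !bsymMr bnn mul1g (b1 _ _ vN tN) mulg1 (bsymC v) !bq // symC.
move=> uN; have [t tN [te qt]] := key u uN.
have uVN : ~~ good u^-1 by rewrite goodV.
have [s sN [se qs]] := key u^-1 uVN.
have es : s = t * u^-1.
  apply: val_inj; rewrite se /= te mulNr mulrDl mul1r mulrV ?(valP u) //.
  by rewrite addrC.
move: qs qt; rewrite es qM // symCA -{1}[qsym u^-1]qV // mulVg mulg1 => ->.
by rewrite mulg1.
Qed.

Lemma qsym1 (u : Au) : qsym u = 1.
Proof.
have [/qsym_good//|uN] := boolP (good u).
have [[a aG aaG]|nosq] := pselect (exists2 a : Au, good a & good (a * a)).
  exact: qsym_bad_sqr aG aaG uN.
have nosq' (a : Au) : good a -> ~~ good (a * a).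
  by move=> aG; apply/negP => aaG; apply: nosq; exists a.
apply: (qsym_bad_opp1 nosq') uN; have [a aG] := exists_good.
(* No good unit has a good square, so -a is bad, and -1 = (-a) a^-1 is good as a product of a bad
   and a good unit. *)
have naN : ~~ good (opp1 A * a).
  by apply: contra (nosq' _ aG) => naG; exact: good_sqr.
rewrite -[opp1 A](mulgK a); rewrite -goodV invgM invgK.
by apply: good_mul; rewrite ?goodV.
Qed.

Lemma sym_gen_antisym (u v : Au) : sym_gen u v * sym_gen v u = 1.
Proof. by have := qsymM u v; rewrite !qsym1 !mul1g. Qed.

End SymbolAntisymmetryLocal.

(** * The crossed module U(A) over the group of units *)

Section CrossedModule.
Variable A : unitRingType.
Local Notation Au := (units A).
Local Notation UC := (coinv (wholeGroup (U_act A))).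
Local Notation "<< u , v >>" := (U_gen u v).

Lemma U_genMl (u v w : Au) : << u * v, w >> = U_act A u << v, w >> * << u, w >>.
Proof.
rewrite U_act_gen /U_gen /pgen -pi_pres_rcat; apply/presP/PresRel; exact: UMulL.
Qed.

Lemma U_gen_cyclic (u v w : Au) :
  << u, v * w >> * << v, w * u >> * << w, u * v >> = 1.
Proof.
rewrite /U_gen /pgen -(pi_pres_rcat _ [:: _] [:: _]) -pi_pres_rcat.
exact/presP/PresRel/UCyclic.
Qed.

Lemma U_gen_steinberg (u v : Au) : steinberg_pair u v -> << u, v >> = 1.
Proof. by move=> uv; apply/presP/PresRel/USteinberg. Qed.

Lemma U_gen1l (w : Au) : << 1, w >> = 1.
Proof.
apply: (mulgI << 1, w >>); rewrite mulg1.
by have := U_genMl 1 1 w; rewrite act1 mulg1 => <-.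
Qed.

(** This is the cyclic relation with first entry 1. *)
Lemma U_gen_antisym (u v : Au) : << u, v >> * << v, u >> = 1.
Proof. by have := U_gen_cyclic 1 u v; rewrite U_gen1l !mul1g mulg1. Qed.

Lemma U_genV (u v : Au) : << u, v >>^-1 = << v, u >>.
Proof. by apply: (mulgI << u, v >>); rewrite mulgV U_gen_antisym. Qed.

Lemma U_genMr (u v w : Au) : << u, v * w >> = << u, v >> * U_act A v << u, w >>.
Proof. by rewrite -U_genV U_genMl invgM U_genV -(morph_groupV (act_morph _ v)) U_genV. Qed.

(* Brown and Loday: expand <<u a, v b>> in the two possible orders. *)
Lemma U_act_comm_gen (u v a b : Au) :
  U_act A (u * v) << a, b >> * << u, v >> =
  << u, v >> * U_act A (v * u) << a, b >>.
Proof.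
have := U_genMl u a (v * b); rewrite !(U_genMr, U_genMl) !act_morph -!actM.
rewrite !mulgA => /mulIg e; apply/esym.
by move: e; rewrite -!mulgA => /mulgI.
Qed.

Lemma U_act_comm (u v : Au) x :
  U_act A (u * v) x * << u, v >> = << u, v >> * U_act A (v * u) x.
Proof.
suff : U_act A (u * v) x = << u, v >> * U_act A (v * u) x * << u, v >>^-1.
  by move=> ->; rewrite mulgVK.
apply: (pres_hom_eq (f := U_act A (u * v))
  (g := fun x => << u, v >> * U_act A (v * u) x * << u, v >>^-1)) => [||[a b]].
- exact: act_morph.
- by move=> y z; rewrite act_morph !mulgA mulgVK.
- by rewrite -[pgen _ _]/(<< a, b >>) -U_act_comm_gen mulgK.
Qed.

(** The Peiffer identity. On a generator, [tau << u, v >>] equals (uv)(vu)^-1, and [U_act_comm] is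
    applied to the image of [x] under (vu)^-1; induction on [y] does the rest. *)
Lemma U_act_tau y x : U_act A (tau y) x = y * x * y^-1.
Proof.
elim/pres_ind: y x => [|[u v]|y IHy|y z IHy IHz] x.
- by rewrite tau1 act1 mul1g invg1 mulg1.
- rewrite -[pgen _ _]/(<< u, v >>) tau_gen; apply: (mulIg << u, v >>).
  rewrite mulgVK -mulgA -invgM actM U_act_comm -actM.
  by rewrite invgM mulgA mulgK mulgV act1.
- apply: (mulgI y); apply: (mulIg y^-1); rewrite -IHy -actM tauV mulgV act1.
  by rewrite !mulgA mulgV mul1g invgK mulgK.
- by rewrite tauM actM IHz IHy invgM !mulgA.
Qed.

Lemma U_classM : {morph coinv_class (wholeGroup (U_act A)) : x y / x * y}.
Proof. by move=> x y; exact: coinv_classM. Qed.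

(** By the Peiffer identity a b a^-1 is an image of b under the action, so both have the same
    class. *)
Lemma U_coinvC (x y : UC) : x * y = y * x.
Proof.
have [a _ <-] := coinv_surj x; have [b _ <-] := coinv_surj y.
rewrite -{2}(coinv_class_act (tau a) (isT : b \in wholeGroup (U_act A))).
by rewrite U_act_tau -!U_classM mulgVK.
Qed.

Lemma U_class_act a x : coinv_class (wholeGroup (U_act A)) (U_act A a x) =
  coinv_class (wholeGroup (U_act A)) x.
Proof. exact: coinv_class_act. Qed.

(** The image of Gamma U(A) is a subgroup containing the generators of Gamma [A^*, A^*] and stable
    under conjugation by [A^*, A^*], because [tau] is onto and equivariant. *)
Lemma tau_gammaSub_surj g : g \in gammaSub (commStable Au) ->
  exists2 x, x \in gammaSub (wholeGroup (U_act A)) & tau x = g.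
Proof.
set I := gammaSub (wholeGroup (U_act A)).
pose S : {pred Au} := fun g => `[< exists2 x, x \in I & tau x = g >].
have SM : mulg_closed S.
  move=> _ _ /asboolP[x xI <-] /asboolP[y yI <-]; apply/asboolP.
  by exists (x * y); rewrite ?tauM ?gpredM.
have S1 : 1 \in S by apply/asboolP; exists 1; rewrite ?tau1 ?gpred1.
have SV : invg_closed S.
  move=> _ /asboolP[x xI <-]; apply/asboolP.
  by exists x^-1; rewrite ?tauV ?gpredV.
pose m1 := isMulClosed.Build Au S SM; pose m2 := isMul1Closed.Build Au S S1.
pose m3 := isInvClosed.Build Au S SV.
pose N : groupClosed Au := HB.pack S m1 m2 m3.
move=> /asboolP gG; suff /asboolP : g \in N by [].
apply: gG => [a _ /tau_surj[x <-]|_ _ /tau_surj[x <-] /asboolP[y yI <-]];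
  apply/asboolP.
  exists (U_act A a x * x^-1); first exact: mem_gammaSub.
  by rewrite tauM tauV tau_act.
by exists (x * y * x^-1); rewrite ?tauM ?tauV // gammaSub_norm.
Qed.

End CrossedModule.

(** * Comparison of the coinvariants of U(A) and Sym(A) *)

Section CoinvariantIsomorphism.
Variables (A : unitRingType) (Aloc : local_ring A).
Hypothesis AF2 : ~ ring_isomorphic (residue A) 'F_2.
Local Notation Au := (units A).
Local Notation UC := (coinv (wholeGroup (U_act A))).
Local Notation Ucl := (coinv_class (wholeGroup (U_act A))).
Local Notation Scl := (coinv_class (wholeGroup (sym_act A))).

Lemma sym_classM : {morph Scl : x y / x * y}.
Proof. by move=> x y; exact: coinv_classM. Qed.

Lemma sym_class_act a x : Scl (sym_act A a x) = Scl x.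
Proof. exact: coinv_class_act. Qed.

Lemma sym_class1 : Scl 1 = 1.
Proof. exact: morph_group1 sym_classM. Qed.

Lemma U_class1 : Ucl 1 = 1.
Proof. exact: morph_group1 (@U_classM A). Qed.

Lemma sym_class_URel w w' : URel w w' ->
  eval_word (fun x : Au * Au => Scl (sym_gen x.1 x.2)) w =
  eval_word (fun x : Au * Au => Scl (sym_gen x.1 x.2)) w'.
Proof.
case=> [u v [_ uv]|u v x|u v x]; rewrite /eval_word !big_cons big_nil /= ?mulg1.
- by rewrite sym_gen_steinberg // sym_class1.
- by rewrite -sym_act_gen sym_class_act sym_genMl symC sym_classM.
- rewrite -!sym_classM -sym_class1; congr (Scl _).
  (* The assumptions on the ring enter through antisymmetry: the cyclic product expands into six
     symbols that cancel in pairs. *)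
  have sV (y z : Au) : sym_gen y z = (sym_gen z y)^-1.
    by apply: (mulIg (sym_gen z y)); rewrite mulVg sym_gen_antisym.
  rewrite !sym_genMr (sV v u) (sV x u) (sV x v).
  move: (sym_gen u v) (sym_gen u x) (sym_gen v x) => a b c.
  by rewrite (symC a b) (symC c) !mulgA mulgK (symC b) mulgK mulgV.
Qed.

(** Coinvariants erase the twist by the action in the multiplicativity of U(A), and their
    commutativity puts the factors in order. *)
Lemma U_class_symRel w w' : symRel w w' ->
  eval_word (fun x : Au * Au => Ucl (U_gen x.1 x.2)) w =
  eval_word (fun x : Au * Au => Ucl (U_gen x.1 x.2)) w'.
Proof.
case=> [u v uv|u u' v|u v v']; rewrite /eval_word !big_cons big_nil /= ?mulg1.
- by rewrite U_gen_steinberg // U_class1.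
- by rewrite U_genMl U_classM U_class_act U_coinvC.
- by rewrite U_genMr U_classM U_class_act.
Qed.

Lemma U_to_SymCoinv : exists p : {multiplicative UA A -> SymCoinv A},
  forall u v : Au, p (U_gen u v) = Scl (sym_gen u v).
Proof.
pose m := isMultiplicative.Build _ _ _ (pres_liftM sym_class_URel).
pose p : {multiplicative UA A -> SymCoinv A} := HB.pack (pres_lift _) m.
exists p => u v; exact: (pres_lift_gen sym_class_URel (u, v)).
Qed.

Lemma SymCoinv_to_UCoinv : exists q : {multiplicative SymCoinv A -> UC},
  forall u v : Au, q (Scl (sym_gen u v)) = Ucl (U_gen u v).
Proof.
pose phi : SymA A -> UC := pres_lift (fun x : Au * Au => Ucl (U_gen x.1 x.2)).
have phiM : {morph phi : x y / x * y} := pres_liftM U_class_symRel.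
have phi_gen (u v : Au) : phi (sym_gen u v) = Ucl (U_gen u v).
  exact: (pres_lift_gen U_class_symRel (u, v)).
have phia a : phi \o sym_act A a =1 phi.
  apply: pres_hom_eq => [x y|//|[u v]]; rewrite /comp; first by rewrite act_morph phiM.
  by rewrite -[pgen _ _]/(sym_gen u v) sym_act_gen !phi_gen -U_act_gen U_class_act.
have [|a x _|q qE] := @coinv_lift _ _ (sym_act A) (wholeGroup _) _ phi.
- by move=> x y _ _; exact: phiM.
- exact: phia.
- by exists q => u v; rewrite qE.
Qed.

End CoinvariantIsomorphism.

(** * The exact sequence of coinvariants *)

Theorem theorem5p8 (A : unitRingType) (Aloc : local_ring A)
    (AF2 : ~ ring_isomorphic (residue A) 'F_2) :
  exists (f : {multiplicative (quo (gammaK2 A)) -> (coinv (K2sub A))})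
         (g : {multiplicative (coinv (K2sub A)) -> (SymCoinv A)})
         (h : {multiplicative (SymCoinv A) -> (coinv (commStable (units A)))})
         (p : {multiplicative (UA A) -> (SymCoinv A)}),
    (* the maps are the canonical ones *)
    [/\ (forall x : UA A, x \in kerGammaTau A ->
           f (coset (gammaK2 A) x) = coinv_class (K2sub A) x),
        (forall u v : units A,
           p (U_gen u v) = coinv_class (wholeGroup (sym_act A)) (sym_gen u v)),
        (forall x : UA A, x \in K2 A -> g (coinv_class (K2sub A) x) = p x) &
        (forall u v : units A,
           h (coinv_class (wholeGroup (sym_act A)) (sym_gen u v)) =
           coinv_class (commStable (units A)) (u * v * u^-1 * v^-1)%g)] /\
    (* the sequence is exact *)
    [/\ injective f, exact_at f g, exact_at g h &
        forall z, exists y, h y = z].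
Proof.
set Ccl := coinv_class (commStable (units A)).
have tauC x : tau x \in commStable (units A) := tau_comm x.
have [p pE] := U_to_SymCoinv Aloc AF2.
have [q qE] := SymCoinv_to_UCoinv A.
have pM : {morph p : x y / x * y} by exact: gmulfM.
have pa a : p \o U_act A a =1 p.
  apply: pres_hom_eq => [x y|x y|[u v]]; rewrite /comp ?act_morph ?gmulfM //.
  by rewrite -[pgen _ _]/(U_gen u v) U_act_gen !pE -sym_act_gen sym_class_act.
(* [q] recovers the class of an element from its image under [p], which bounds the kernel of [p] by
   Gamma U(A). *)
have qp : q \o p =1 coinv_class (wholeGroup (U_act A)).
  apply: pres_hom_eq => [x y||[u v]]; rewrite /comp ?gmulfM //.
    exact: U_classM.
  by rewrite -[pgen _ _]/(U_gen u v) pE qE.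
have p_ker x : p x = 1 <-> x \in gammaSub (wholeGroup (U_act A)).
  split=> [px|]; first by apply/coinv_class_eq1; rewrite // -[LHS]qp /= px morph_group1 //; exact: gmulfM.
  apply: gammaSub_ker => [y z _ _|a y _]; [exact: gmulfM | exact: pa].
have p_surj z : exists x, p x = z.
  have [s _ <-] := coinv_surj z.
  elim/pres_ind: s => [|[u v]|s [x xE]|s t [x xE] [y yE]].
  - by exists 1; rewrite sym_class1 morph_group1 //; exact: gmulfM.
  - by exists (U_gen u v); rewrite pE.
  - exists x^-1; rewrite (morph_groupV pM) xE.
    by rewrite -(morph_groupV (@sym_classM A)).
  - by exists (x * y); rewrite gmulfM xE yE sym_classM.
have kerK2 : {subset kerGammaTau A <= K2 A} by move=> x /andP[].
have [||f fE] := @quo_lift _ _ (gammaK2 A) _ (coinv_class (K2sub A)).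
- by move=> x y /kerK2 xK /kerK2 yK; exact: coinv_classM.
- move=> x xG; have xK : x \in K2sub A := gammaSub_sub xG.
  exact/(coinv_class_eq1 xK).
have [||g gE] := @coinv_lift _ _ (U_act A) (K2sub A) _ p.
- by move=> x y _ _; exact: gmulfM.
- by move=> a x _; exact: pa.
have [||t tE] := @coinv_lift _ _ (U_act A) (wholeGroup _) _ (Ccl \o @tau A).
- by move=> x y _ _ /=; rewrite tauM /Ccl coinv_classM ?tauC.
- move=> a x _ /=; rewrite tau_act.
  exact: (coinv_class_act a (tauC x)).
(* [h] goes back through [q] to the coinvariants of U(A), then follows the map [t] induced by
   [tau]. *)
have [h hp] : exists h : {multiplicative SymCoinv A -> _},
    forall x, h (p x) = Ccl (tau x).
  by exists (t \o q) => x; rewrite -[RHS]tE // -qp.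
exists f, g, h, p; split; split=> //.
- by move=> u v; rewrite -pE hp tau_gen.
- apply: morph_group_inj => [|y]; first exact: gmulfM.
  have [x xK <-] := coset_surj y; rewrite fE // => /coinv_class_eq1 xG.
  exact/coset_eq1/xG/kerK2.
(* The kernel of [g] comes from the elements of K_2(A) lying in Gamma U(A), that is, from Ker
   Gamma(tau). *)
- move=> y; split=> [|[z <-]].
    have [x xK <-] := coinv_surj y; rewrite gE // => /p_ker xG.
    exists (coset (gammaK2 A) x); apply: fE.
    by apply/andP; split.
  have [x xG <-] := coset_surj z; rewrite fE // gE ?kerK2 //.
  by apply/p_ker; case/andP: xG.
- move=> z; split=> [|[y <-]].
    have [x <-] := p_surj z; rewrite hp => /(coinv_class_eq1 (tauC x)).
    (* Surjectivity of Gamma(tau) corrects [x] by some [y] in Gamma U(A): [x / y] falls into K_2(A),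
       and [p] kills [y]. *)
    move=> /tau_gammaSub_surj[y yG xy].
    have xyK : x / y \in K2sub A.
      by apply/eqP; rewrite tauM tauV xy mulgV.
    exists (coinv_class (K2sub A) (x / y)); rewrite gE // (morph_groupF pM).
    by have /p_ker -> := yG; rewrite divg1.
  have [x xK <-] := coinv_surj y; rewrite gE // hp (eqP xK).
  by apply/coinv_class_eq1; rewrite gpred1.
- move=> y; have [c cC <-] := coinv_surj y; have [x <-] := tau_surj cC.
  by exists (p x); rewrite hp.
Qed.
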